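(* Let $\omega:[0,1)\to(0,1)$ be a function such that $\sup_{r\in[0,1)}\omega(r)<1$ and $\lim_{r\to1^-}\omega(r)=0$. Then there exists a non-constant singular inner function $S$ on the open unit disk $\mathbb{D}$ such that \[ \min_{|z|\le r}|S(z)|\ge\omega(r)\quad\text{for all } r\in[0,1). \]
   Context: $\mathbb{D}=\{z\in\mathbb{C}:|z|<1\}$ is the open unit disk and $\mathbb{T}=\{z\in\mathbb{C}:|z|=1\}$ is the unit circle. A singular inner function on $\mathbb{D}$ is a function of the form \[ S(z)=\exp\Bigl(-\int_{\mathbb{T}}\frac{e^{i\theta}+z}{e^{i\theta}-z}\,d\mu(\theta)\Bigr)\quad(z\in\mathbb{D}), \] where $\mu$ is a positive finite (Borel) measure on $\mathbb{T}$ that is singular with respect to linear Lebesgue (arclength) measure on $\mathbb{T}$; points of $\mathbb{T}$ are written $e^{i\theta}$ and $\mu$ is regarded as a measure in the variable $\theta$. *)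

(* Defs.v *)
From HB Require Import structures.
From mathcomp Require Import all_boot all_order all_algebra.
From mathcomp Require Import complex.
From mathcomp Require Import all_classical all_reals all_analysis.
Import Order.TTheory GRing.Theory Num.Theory.
Import numFieldNormedType.Exports.

Set Implicit Arguments.
Unset Strict Implicit.
Unset Printing Implicit Defensive.

Local Open Scope classical_set_scope.
Local Open Scope ring_scope.
Local Open Scope complex_scope.

(* Real-valued modulus |a + ib| = sqrt (a^2 + b^2); the norm `|z| of z : R[i]
   is an element of R[i]. *)
Definition cmod (R : realType) (z : R[i]) : R := ComplexField.Normc.normc z.

Definition cexp (R : realType) (z : R[i]) : R[i] :=
  (expR (complex.Re z))%:C *
    (cos (complex.Im z) +i* sin (complex.Im z)).

Definition unit_disk (R : realType) : set R[i] := [set z | cmod z < 1].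

(* The circle is parametrized bijectively by [0, 2 pi[, t standing for the
   point e^(it). *)
Definition circle_param (R : realType) : set R := `[0, 2 * pi[.

Definition circle_pt (R : realType) (t : R) : R[i] := cexp (0 +i* t).

(* Lebesgue integral of a complex-valued function, componentwise. *)
Definition cintegral (R : realType)
    (mu : {measure set (measurableTypeR R) -> \bar R})
    (D : set R) (f : R -> R[i]) : R[i] :=
  Rintegral mu D (fun t => complex.Re (f t)) +i*
  Rintegral mu D (fun t => complex.Im (f t)).

(* A Borel measure on the circle, seen as a measure in the variable t: a Borel
   measure on the line that is carried by [0, 2 pi[. *)
Definition on_circle (R : realType)
    (mu : {measure set (measurableTypeR R) -> \bar R}) : Prop :=
  mu (~` @circle_param R) = 0%E.

(* Arclength corresponds to Lebesgue measure in the variable t. *)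
Definition lebesgue_singular (R : realType)
    (mu : {measure set (measurableTypeR R) -> \bar R}) : Prop :=
  exists N : set (measurableTypeR R),
    [/\ measurable N, lebesgue_measure N = 0%E & mu (~` N) = 0%E].

(* Only the values of S on the unit disk are constrained. *)
Definition singular_inner (R : realType) (S : R[i] -> R[i]) : Prop :=
  exists mu : {finite_measure set (measurableTypeR R) -> \bar R},
    [/\ on_circle mu, lebesgue_singular mu &
      forall z, unit_disk z ->
        S z = cexp (- cintegral mu (@circle_param R)
                        (fun t => (circle_pt t + z) / (circle_pt t - z)))].

Definition nonconstant_on_disk (R : realType) (S : R[i] -> R[i]) : Prop :=
  ~ exists c : R[i], forall z, unit_disk z -> S z = c.

(* m is the (attained) minimum of A. *)
Definition is_min (R : realType) (A : set R) (m : R) : Prop :=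
  A m /\ lbound A m.

(* Main.v *)
Require Import Defs.
From HB Require Import structures.
From mathcomp Require Import all_boot all_order all_algebra.
From mathcomp Require Import complex ring lra zify.
From mathcomp Require Import all_classical all_reals all_analysis measurable_realfun.
Import Order.TTheory GRing.Theory Num.Theory.
Import numFieldNormedType.Exports.
Local Open Scope classical_set_scope.
Local Open Scope ring_scope.
Local Open Scope complex_scope.

(** Taking moduli turns the theorem into a statement about Poisson integrals:
    |S(z)| = exp(-P[mu](z)), so one needs a nonzero singular measure mu with
    P[mu](z) <= -ln (omega r) for |z| <= r.  The right-hand side is at least
    lam = -ln (sup omega) > 0 and tends to infinity as r -> 1, possibly very
    slowly; hence mu has to look like a multiple of arclength down to very
    small scales, the multiple being allowed to grow as the scale shrinks.

    The measure is a Cantor measure.  Put t = 2 pi X, where the binary digits of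
    X in [0, 1] are zero at a prescribed set of forced positions and are
    independent fair bits elsewhere.  If k of the first L digits are forced,
    every dyadic arc of length 2 pi / 2^L carries at most the fraction
    2^(k - L) of the mass, while the support is covered by 2^(L - k) such arcs.
    As k -> oo the support is Lebesgue null (cantor_measure_singular).  The law
    of X is realised as the image of the uniform law under cantor_map, which
    spreads the digits of its argument over the free positions.

    For the upper bound, the Poisson kernel changes by a factor at most 2 on an
    arc of length 2 pi / 2^L as soon as 8 pi <= 2^L (1 - r)^2
    (poisson_harnack), so P[mu](z) is at most 2^(k+1) times the total mass times
    the average of the Poisson kernel over the 2^L-th roots of unity.  The
    identity P(z, t) + P(z, t + pi) = 2 P(z^2, 2 t), iterated L times, reduces
    this average to one value of the kernel at z^(2^L), which is at most 2
    (poisson_roots_sum).  Hence P[mu] <= 4 2^k mu(T) on |z| <= r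
    (potential_le).

    It remains to force digits rarely enough.  Choose radii r_j -> 1 with
    -ln (omega r) >= lam 2^j on [r_j, 1), and forbid a (j+1)-st forced position
    before a level T_j at which the estimate above is valid for r_j
    (rate_thresholds, nforced_threshold).  With total mass lam / 8 the bound
    becomes P[mu] <= lam 2^j <= -ln (omega r) for r_j <= r < r_(j+1).

    The first digit is forced (T_0 = 0), so mu lives on the upper half circle;
    this makes P[mu](-i/2) < P[mu](0), and S is not constant.  Minima of |S| on
    closed disks are attained because P[mu] is Lipschitz there.  *)

(** * The Poisson kernel *)

Section poisson_kernel.
Variable R : realType.
Implicit Types x y r t s : R.

Definition poisson_denom x y t : R :=
  1 + (x ^+ 2 + y ^+ 2) - 2 * (x * cos t + y * sin t).

(** The Poisson kernel of the disk at z = x + i y and e^(it); its denominator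
    is |e^(it) - z|^2. *)
Definition poisson x y t : R := (1 - (x ^+ 2 + y ^+ 2)) / poisson_denom x y t.

(** The left-hand side is |z e^(-it)|^2; it bounds x cos t + y sin t by |z|. *)
Lemma rotate_sqr x y t :
  (x * cos t + y * sin t) ^+ 2 + (x * sin t - y * cos t) ^+ 2 = x ^+ 2 + y ^+ 2.
Proof.
have -> : (x * cos t + y * sin t) ^+ 2 + (x * sin t - y * cos t) ^+ 2
  = (x ^+ 2 + y ^+ 2) * (cos t ^+ 2 + sin t ^+ 2) by ring.
by rewrite cos2Dsin2 mulr1.
Qed.

Lemma poisson_denom_ge {r x y} t : 0 <= r < 1 -> x ^+ 2 + y ^+ 2 <= r ^+ 2 ->
  (1 - r) ^+ 2 <= poisson_denom x y t.
Proof.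
move=> /andP[r0 r1] hN; have hu := rotate_sqr x y t; rewrite /poisson_denom.
set u := x * cos t + y * sin t in hu *.
set v := x * sin t - y * cos t in hu *.
have uN : u ^+ 2 <= x ^+ 2 + y ^+ 2 by rewrite -hu lerDl sqr_ge0.
have ur : u <= r.
  rewrite leNgt; apply/negP => ru; nra.
nra.
Qed.

Lemma disk_radius {x y} : x ^+ 2 + y ^+ 2 < 1 ->
  exists2 r, 0 <= r < 1 & x ^+ 2 + y ^+ 2 <= r ^+ 2.
Proof.
move=> h; exists (Num.sqrt (x ^+ 2 + y ^+ 2)).
  by rewrite sqrtr_ge0/= -sqrtr1 ltr_sqrt.
by rewrite sqr_sqrtr// addr_ge0// sqr_ge0.
Qed.

Lemma poisson_denom_gt0 {x y} t : x ^+ 2 + y ^+ 2 < 1 ->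
  0 < poisson_denom x y t.
Proof.
move=> /disk_radius[r r01 xyr].
apply: lt_le_trans (poisson_denom_ge t r01 xyr).
by rewrite exprn_gt0//; move/andP: r01 => [_]; rewrite subr_gt0.
Qed.

Lemma poisson_ge0 x y t : x ^+ 2 + y ^+ 2 < 1 -> 0 <= poisson x y t.
Proof.
move=> h; apply: divr_ge0; first by rewrite subr_ge0 ltW.
exact/ltW/poisson_denom_gt0.
Qed.

(** Averaging over the two square roots of e^(2it) amounts to squaring z: the
    right-hand side is the kernel at z^2 and e^(2it), because
    |e^(it) - z| |e^(it) + z| = |e^(2it) - z^2|. *)
Lemma poisson_pair x y t : x ^+ 2 + y ^+ 2 < 1 ->
  poisson x y t + poisson x y (t + pi) =
  2 * poisson (x ^+ 2 - y ^+ 2) (2 * x * y) (2 * t).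
Proof.
move=> h; have h2 : (x ^+ 2 - y ^+ 2) ^+ 2 + (2 * x * y) ^+ 2 < 1.
  have -> : (x ^+ 2 - y ^+ 2) ^+ 2 + (2 * x * y) ^+ 2 = (x ^+ 2 + y ^+ 2) ^+ 2
    by ring.
  by rewrite expr_lt1// addr_ge0// sqr_ge0.
have := poisson_denom_gt0 t h; have := poisson_denom_gt0 (t + pi) h.
have := poisson_denom_gt0 (2 * t) h2.
rewrite /poisson /poisson_denom cosDpi sinDpi [2 * t]mulr_natl sin_mulr2n cos_mulr2n.
have := cos2Dsin2 t; set c := cos t; set s := sin t => cs.
move=> d1 d2 d3.
have dd : 1 + ((x ^+ 2 - y ^+ 2) ^+ 2 + (2 * x * y) ^+ 2) -
   2 * ((x ^+ 2 - y ^+ 2) * (c ^+ 2 *+ 2 - 1) + 2 * x * y * ((c * s) *+ 2)) =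
  (1 + (x ^+ 2 + y ^+ 2) - 2 * (x * c + y * s)) *
  (1 + (x ^+ 2 + y ^+ 2) - 2 * (x * - c + y * - s)).
  have s2 : s ^+ 2 = 1 - c ^+ 2 by rewrite -cs; ring.
  ring: s2.
rewrite dd; field; by rewrite !gt_eqF.
Qed.

Lemma poisson_le2 x y t : x ^+ 2 + y ^+ 2 <= (4^-1) ^+ 2 -> poisson x y t <= 2.
Proof.
move=> h; have h1 : x ^+ 2 + y ^+ 2 < 1.
  by apply: le_lt_trans h _; lra.
rewrite /poisson ler_pdivrMr ?poisson_denom_gt0//.
have r01 : 0 <= (4^-1 : R) < 1 by apply/andP; split; lra.
have := poisson_denom_ge t r01 h.
have : 0 <= x ^+ 2 + y ^+ 2 by rewrite addr_ge0// sqr_ge0.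
by move=> ? ?; lra.
Qed.

Lemma sum_two_halves (f : nat -> R) m :
  \sum_(j < 2 * m) f j = \sum_(j < m) (f j + f (m + j)%N).
Proof. by rewrite mul2n -addnn big_split_ord/= -big_split. Qed.

(** Each use of poisson_pair halves the number of points and squares z, so the
    average over 2^L equidistant points is a single value of the kernel at
    z^(2^L), where the kernel is at most 2 by hypothesis. *)
Lemma poisson_roots_sum L x y t : x ^+ 2 + y ^+ 2 < 1 ->
  (x ^+ 2 + y ^+ 2) ^+ (2 ^ L) <= (4^-1) ^+ 2 ->
  \sum_(j < 2 ^ L) poisson x y (t + 2 * pi * (j%:R / 2 ^+ L)) <= 2 * 2 ^+ L.
Proof.
elim: L x y t => [|L IH] x y t h1 hL.
  by rewrite big_ord1 mulr1 poisson_le2.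
rewrite expnS (sum_two_halves (fun j => poisson x y (t + 2 * pi * (j%:R / 2 ^+ L.+1)))).
have N2 : (x ^+ 2 - y ^+ 2) ^+ 2 + (2 * x * y) ^+ 2 = (x ^+ 2 + y ^+ 2) ^+ 2
  by ring.
rewrite (eq_bigr (fun j : 'I_(2 ^ L) => 2 *
    poisson (x ^+ 2 - y ^+ 2) (2 * x * y) (2 * t + 2 * pi * (j%:R / 2 ^+ L)))).
  rewrite -mulr_sumr (exprS 2 L) ler_pM2l//.
  apply: IH; rewrite N2; last by rewrite -exprM -expnS.
  by rewrite expr_lt1// addr_ge0// sqr_ge0.
move=> j _; set s := t + 2 * pi * (j%:R / 2 ^+ L.+1).
have -> : t + 2 * pi * ((2 ^ L + j)%:R / 2 ^+ L.+1) = s + pi.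
  by rewrite /s natrD natrX (exprS 2 L); field; rewrite expf_neq0.
rewrite poisson_pair//; congr (_ * poisson _ _ _).
by rewrite /s (exprS 2 L); field; rewrite expf_neq0.
Qed.

Lemma cos_lip s t : `|cos s - cos t| <= `|s - t|.
Proof.
wlog ts : s t / t < s.
  move=> H; have [->|] := eqVneq s t; first by rewrite !subrr normr0.
  by rewrite neq_lt => /orP[/H|/H//]; rewrite distrC (distrC t).
have [|c _ ->] := @MVT R cos (- sin) t s ts (fun x _ => is_derive_cos x).
  by apply: continuous_subspaceT; exact: continuous_cos.
by rewrite normrM normrN ler_piMl// ler_norml sin_geN1 sin_le1.
Qed.

Lemma sin_lip s t : `|sin s - sin t| <= `|s - t|.
Proof. have := cos_lip (s - pi / 2) (t - pi / 2).
have cosB u : cos (u - pi / 2) = sin u by rewrite -sinDpihalf subrK.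
by rewrite !cosB opprB addrA subrK. Qed.

Lemma coord_le1 {x y} : x ^+ 2 + y ^+ 2 < 1 -> `|x| <= 1 /\ `|y| <= 1.
Proof.
move=> h; have := sqr_ge0 x; have := sqr_ge0 y => y0 x0.
by split; rewrite -[_ <= 1](@ler_pXn2r _ 2)// ?nnegrE// expr1n
  real_normK ?num_real//; lra.
Qed.

Lemma poisson_denom_lip {x y} t s : x ^+ 2 + y ^+ 2 < 1 ->
  poisson_denom x y s <= poisson_denom x y t + 4 * `|t - s|.
Proof.
move=> /coord_le1[x1 y1]; rewrite /poisson_denom.
have hx : x * (cos t - cos s) <= `|t - s|.
  apply: le_trans (ler_norm _) _; rewrite normrM.
  by apply: le_trans (cos_lip t s); rewrite ler_piMl.
have hy : y * (sin t - sin s) <= `|t - s|.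
  apply: le_trans (ler_norm _) _; rewrite normrM.
  by apply: le_trans (sin_lip t s); rewrite ler_piMl.
lra.
Qed.

(** The denominator is at least (1 - r)^2 and 4-Lipschitz in the angle, so it at
    most doubles over such a short arc. *)
Lemma poisson_harnack {r x y} t s : 0 <= r < 1 ->
  x ^+ 2 + y ^+ 2 <= r ^+ 2 -> 4 * `|t - s| <= (1 - r) ^+ 2 ->
  poisson x y t <= 2 * poisson x y s.
Proof.
move=> r01 xyr hts; have [r0 r1] := andP r01.
have h1 : x ^+ 2 + y ^+ 2 < 1.
  by apply: le_lt_trans xyr _; rewrite expr_lt1.
rewrite /poisson mulrCA ler_pM2l ?subr_gt0//.
rewrite -[_^-1]mul1r ler_pdivrMr ?poisson_denom_gt0// mulrAC.
rewrite ler_pdivlMr ?poisson_denom_gt0// mul1r.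
have := poisson_denom_lip t s h1; have := poisson_denom_ge t r01 xyr; lra.
Qed.

Lemma poisson_lip r x y x' y' t : 0 <= r < 1 ->
  x ^+ 2 + y ^+ 2 <= r ^+ 2 -> x' ^+ 2 + y' ^+ 2 <= r ^+ 2 ->
  `|poisson x y t - poisson x' y' t| <=
  12 / (1 - r) ^+ 4 * (`|x - x'| + `|y - y'|).
Proof.
move=> r01 hz hw; have [r0 r1] := andP r01.
have rr1 : r ^+ 2 < 1 by rewrite expr_lt1.
have hz1 := le_lt_trans hz rr1; have hw1 := le_lt_trans hw rr1.
have [x1 y1] := coord_le1 hz1; have [x'1 y'1] := coord_le1 hw1.
have := poisson_denom_ge t r01 hz; have := poisson_denom_ge t r01 hw.
have := poisson_denom_gt0 t hz1; have := poisson_denom_gt0 t hw1.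
rewrite /poisson.
set D := poisson_denom x y t; set D' := poisson_denom x' y' t.
set d := `|x - x'| + `|y - y'|; move=> D'0 D0 D'r Dr.
have d0 : 0 <= d by rewrite addr_ge0.
pose N := x ^+ 2 + y ^+ 2; pose N' := x' ^+ 2 + y' ^+ 2.
have N0 : 0 <= N by rewrite addr_ge0// sqr_ge0.
have NN' : `|N - N'| <= 2 * d.
  have -> : N - N' = (x - x') * (x + x') + (y - y') * (y + y').
    by rewrite /N /N'; ring.
  apply: le_trans (ler_normD _ _) _; rewrite !normrM /d mulrDr.
  by apply: lerD; rewrite mulrC; apply: ler_wpM2r => //;
    apply: le_trans (ler_normD _ _) _; lra.
have DD' : `|D' - D| <= 4 * d.
  have -> : D' - D = (N' - N) + (2 * cos t * (x - x') + 2 * sin t * (y - y')).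
    by rewrite /D /D' /poisson_denom /N /N'; ring.
  apply: le_trans (ler_normD _ _) _.
  have ht : `|2 * cos t * (x - x') + 2 * sin t * (y - y')| <= 2 * d.
    apply: le_trans (ler_normD _ _) _; rewrite !normrM ger0_norm// /d mulrDr.
    by apply: lerD; apply: ler_wpM2r => //; rewrite ler_piMr// ler_norml
      ?cos_geN1 ?cos_le1 ?sin_geN1 ?sin_le1.
  rewrite distrC in NN'; lra.
have D4 : D <= 4.
  have : - (x * cos t + y * sin t) <= 1.
    have := rotate_sqr x y t; rewrite -/N => h.
    have v0 := sqr_ge0 (x * sin t - y * cos t).
    rewrite leNgt; apply/negP => u1; move: hz1; rewrite -/N => hz1; nra.
  by move: hz1; rewrite /D /poisson_denom; lra.
have -> : (1 - N) / D - (1 - N') / D' =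
    ((1 - N) * (D' - D) + D * (N' - N)) / (D * D').
  by field; rewrite !gt_eqF.
rewrite normrM normfV (ger0_norm (ltW (mulr_gt0 D0 D'0))) mulrAC.
apply: ler_pM => //; first by rewrite invr_ge0 mulr_ge0// ltW.
  apply: le_trans (ler_normD _ _) _; rewrite !normrM.
  rewrite (ger0_norm (ltW D0)) ger0_norm ?subr_ge0 ?(ltW hz1)//.
  have e1 : (1 - N) * `|D' - D| <= 1 * (4 * d).
    by apply: ler_pM => //; [rewrite subr_ge0 ltW|lra].
  have e2 : D * `|N' - N| <= 4 * (2 * d).
    by apply: ler_pM => //; [exact: ltW|rewrite distrC].
  lra.
have r2 : 0 < (1 - r) ^+ 2 by rewrite exprn_gt0// subr_gt0.
rewrite lef_pV2 ?posrE ?mulr_gt0// ?exprn_gt0 ?subr_gt0//.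
have -> : (1 - r) ^+ 4 = (1 - r) ^+ 2 * (1 - r) ^+ 2 by rewrite -exprD.
by apply: ler_pM => //; exact: ltW.
Qed.

Lemma measurable_poisson x y : x ^+ 2 + y ^+ 2 < 1 ->
  measurable_fun setT (poisson x y : measurableTypeR R -> R).
Proof.
move=> xy1; apply: continuous_measurable_fun => t.
apply: (@cvgM R R^o); first exact: cvg_cst.
apply: cvgV; first by rewrite gt_eqF// poisson_denom_gt0.
apply: (@cvgB R R^o); first exact: cvg_cst.
apply: (@cvgM R R^o); first exact: cvg_cst.
apply: (@cvgD R R^o); apply: (@cvgM R R^o);
  [exact: cvg_cst|exact: continuous_cos|exact: cvg_cst|exact: continuous_sin].
Qed.

(** A quantitative form of r^n -> 0: the single condition
    8 pi <= 2^L (1 - r)^2 then also makes r^(2^L) small. *)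
Lemma bernoulli_decay r n : 0 <= r <= 1 ->
  r ^+ n * (1 + n%:R * (1 - r)) <= 1.
Proof.
move=> /andP[r0 r1]; elim: n => [|n IH]; first by rewrite mul0r addr0 mulr1.
apply: le_trans IH; rewrite exprSr -mulrA ler_wpM2l ?exprn_ge0//.
rewrite -natr1; have : 0 <= n%:R :> R by []; set k := n%:R => k0.
have := sqr_ge0 (1 - r); have := mulr_ge0 k0 (sqr_ge0 (1 - r)); lra.
Qed.

End poisson_kernel.

(** * Inserting zero digits *)

Section forced_digits.
Variable T : nat -> nat.

(** Greedy choice of the forced positions: after j of them, the next one is the
    first later position which is at least T j.  nforced L and nfree L count the
    forced and the free positions below L. *)
Fixpoint nforced (L : nat) : nat :=
  if L is L'.+1 then (nforced L' + (T (nforced L') <= L'))%N else 0%N.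

Definition forced (L : nat) : bool := (T (nforced L) <= L)%N.

Fixpoint nfree (L : nat) : nat :=
  if L is L'.+1 then (nfree L' + ~~ forced L')%N else 0%N.

Lemma nforced_nfree L : (nforced L + nfree L)%N = L.
Proof.
elim: L => //= L IH; rewrite -[in RHS]IH -/(forced L).
by case: (forced L) => /=; lia.
Qed.

Lemma nforced_gt L j : (j < nforced L)%N -> (T j < L)%N.
Proof.
elim: L => //= L IH; have [/IH h _|h] := ltnP j (nforced L).
  exact: ltnW.
case: (leqP (T (nforced L)) L) => hT /=; last by rewrite addn0 ltnNge h.
rewrite addn1 ltnS => h2; move: hT.
by have -> : j = nforced L by apply/eqP; rewrite eqn_leq h h2.
Qed.

(** The (j+1)-st forced position is at least T j. *)
Lemma nforced_threshold j : (nforced (T j) <= j)%N.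
Proof. by rewrite leqNgt; apply/negP => /nforced_gt; rewrite ltnn. Qed.

Lemma nforced_homo L M : (L <= M)%N -> (nforced L <= nforced M)%N.
Proof.
move=> /subnK <-; elim: (M - L)%N => //= k IH.
exact: leq_trans IH (leq_addr _ _).
Qed.

Lemma nforced_unbounded j : exists L, (j <= nforced L)%N.
Proof.
elim: j => [|j [L hL]]; first by exists 0%N.
have [|h] := ltnP j (nforced L); first by exists L.
set M := maxn L (T j); have hM : (j <= nforced M)%N.
  by apply: leq_trans hL (nforced_homo _ _ _); rewrite leq_maxl.
have [|h2] := ltnP j (nforced M); first by exists M.
exists M.+1 => /=; have -> : nforced M = j by apply/eqP; rewrite eqn_leq h2 hM.
by rewrite leq_maxr addn1.
Qed.

(** The first L binary digits of the image, read as an integer, when i holds the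
    first nfree L digits of the argument. *)
Fixpoint insert0 (L i : nat) : nat :=
  if L is L'.+1 then
    if forced L' then (2 * insert0 L' i)%N
    else (2 * insert0 L' i./2 + odd i)%N
  else 0%N.

Lemma insert0_ltn L i j :
  (i < j < 2 ^ nfree L)%N -> (insert0 L i < insert0 L j)%N.
Proof.
elim: L i j => [|L IH] i j /=; first by rewrite expn0; lia.
case: ifP => hL; first by rewrite addn0 ltn_pmul2l//; exact: IH.
rewrite addn1 expnS => /andP[ij jL].
have [h|h|h] := ltngtP i./2 j./2.
- have := IH i./2 j./2; rewrite h /=; have -> : (j./2 < 2 ^ nfree L)%N by lia.
  by move=> /(_ isT); case: (odd i); case: (odd j) => /=; lia.
- lia.
- by rewrite h; case: (odd i) (odd_double_half i);
    case: (odd j) (odd_double_half j) => /=; lia.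
Qed.

Lemma insert0_leq L i j :
  (i <= j < 2 ^ nfree L)%N -> (insert0 L i <= insert0 L j)%N.
Proof.
rewrite leq_eqVlt => /andP[/predU1P[->//|ij] jL].
by apply/ltnW/insert0_ltn; rewrite ij.
Qed.

Variable R : realType.

Lemma sum_parity (f : nat -> R) m :
  \sum_(j < 2 * m) f j = \sum_(j < m) (f (2 * j)%N + f (2 * j + 1)%N).
Proof.
elim: m => [|m IH]; first by rewrite !big_ord0.
have -> : (2 * m.+1 = (2 * m).+2)%N by lia.
by rewrite !big_ord_recr/= IH addrA addn1.
Qed.

(** insert0 L is injective from nfree L-bit to L-bit integers, and a nonnegative
    sum only grows when it is extended from the image to all L-bit integers. *)
Lemma sum_insert0 L (c : nat -> R) : (forall j, 0 <= c j) ->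
  \sum_(i < 2 ^ nfree L) c (insert0 L i) <= \sum_(j < 2 ^ L) c j.
Proof.
elim: L c => [|L IH] c c0; first by rewrite /= !expn0 !big_ord1.
rewrite expnS sum_parity /=; case: (forced L) => /=.
  rewrite addn0; apply: (le_trans (IH (fun j => c (2 * j)%N) (fun j => c0 _))).
  by apply: ler_sum => j _; rewrite lerDl.
rewrite addn1 expnS.
rewrite (sum_parity (fun i => c (2 * insert0 L i./2 + odd i)%N)).
apply: le_trans (IH (fun j => c (2 * j)%N + c (2 * j + 1)%N)
  (fun j => addr_ge0 (c0 _) (c0 _))).
apply: ler_sum => i _.
have -> : (2 * i)./2 = i by rewrite mul2n doubleK.
have -> : (2 * i + 1)./2 = i by lia.
by rewrite oddD oddM /= addn0.
Qed.

(** The first nfree L binary digits of x in [0, 1[, read as an integer.  The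
    minimum keeps the value below 2^nfree L for every real x. *)
Definition free_index (L : nat) (x : R) : nat :=
  minn (Num.truncn (2 ^+ nfree L * x)) (2 ^ nfree L).-1.

Definition digit_approx (L : nat) (x : R) : R :=
  (insert0 L (free_index L x))%:R / 2 ^+ L.

Lemma free_index_lt L x : (free_index L x < 2 ^ nfree L)%N.
Proof.
by have := expn_gt0 2 (nfree L); rewrite /free_index; lia.
Qed.

Lemma free_index_homo L x y :
  x <= y -> (free_index L x <= free_index L y)%N.
Proof.
move=> xy; rewrite /free_index leq_min geq_minr andbT.
apply: leq_trans (geq_minl _ _) _.
by apply: le_truncn; rewrite ler_pM2l ?exprn_gt0.
Qed.

Lemma truncn_half (x : R) : (Num.truncn (2 * x))./2 = Num.truncn x.
Proof.
have [x0|x0] := leP 0 x; last first.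
  by rewrite !(elimT (truncn0Pn _)) //; lra.
apply/esym/truncn_def.
have /andP[] := truncn_itv (mulr_ge0 (ler0n R 2) x0).
set n := Num.truncn _ => h1 h2.
have e := odd_double_half n.
have e' : n%:R = (odd n)%:R + 2 * n./2%:R :> R.
  by rewrite -[in LHS]e natrD -muln2 natrM mulrC.
rewrite -natr1 in h2; rewrite -natr1; case: (odd n) e' => /= e'; lra.
Qed.

Lemma free_index_forced L x : forced L -> free_index L.+1 x = free_index L x.
Proof. by rewrite /free_index /= => ->; rewrite addn0. Qed.

Lemma free_index_free L x : ~~ forced L ->
  (free_index L.+1 x)./2 = free_index L x.
Proof.
rewrite /free_index /= => ->; rewrite addn1 exprS expnS -mulrA.
rewrite -(truncn_half (2 ^+ nfree L * x)).
by have := expn_gt0 2 (nfree L); lia.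
Qed.

(** The dyadic intervals of length 2^-L starting at digit_approx L x are
    nested. *)
Lemma digit_approx_step L x :
  digit_approx L x <= digit_approx L.+1 x /\
  digit_approx L.+1 x + (2 ^+ L.+1)^-1 <= digit_approx L x + (2 ^+ L)^-1.
Proof.
have [b hb] : exists b : bool,
    insert0 L.+1 (free_index L.+1 x) = (2 * insert0 L (free_index L x) + b)%N.
  have [hL|hL] := boolP (forced L).
    by exists false; rewrite addn0 /= hL free_index_forced.
  exists (odd (free_index L.+1 x)); rewrite -(free_index_free _ _ hL).
  by rewrite [LHS]/= (negbTE hL).
rewrite /digit_approx hb exprS invfM natrD natrM.
have : 0 < (2 ^+ L)^-1 :> R by rewrite invr_gt0 exprn_gt0.
set a : R := (insert0 _ _)%:R; set q : R := (2 ^+ L)^-1 => q0.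
by case: b {hb} => /=; split; lra.
Qed.

Lemma digit_approx_homo L : {homo digit_approx L : x y / x <= y}.
Proof.
move=> x y xy; rewrite /digit_approx ler_pM2r ?invr_gt0 ?exprn_gt0//.
by rewrite ler_nat insert0_leq// free_index_lt free_index_homo.
Qed.

Definition cantor_map (x : R) : R := limn (digit_approx ^~ x).

Lemma digit_approx_nd x : nondecreasing_seq (digit_approx ^~ x).
Proof. by apply/nondecreasing_seqP => L; have [] := digit_approx_step L x. Qed.

Lemma digit_approx_upper x :
  nonincreasing_seq (fun L => digit_approx L x + (2 ^+ L)^-1).
Proof. by apply/nonincreasing_seqP => L; have [] := digit_approx_step L x. Qed.

Lemma digit_approx_le L M x :
  digit_approx M x <= digit_approx L x + (2 ^+ L)^-1.
Proof.
have [LM|/ltnW ML] := leqP L M.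
  by apply: le_trans (digit_approx_upper x _ _ LM); rewrite lerDl invr_ge0 exprn_ge0.
by apply: le_trans (digit_approx_nd x _ _ ML) _; rewrite lerDl invr_ge0 exprn_ge0.
Qed.

Lemma digit_approx_cvg x : cvgn (digit_approx ^~ x).
Proof.
apply: nondecreasing_is_cvgn (digit_approx_nd x) _.
by exists (digit_approx 0 x + (2 ^+ 0)^-1) => _ [M _ <-]; exact: digit_approx_le.
Qed.

Lemma cantor_map_ge L x : digit_approx L x <= cantor_map x.
Proof. exact: nondecreasing_cvgn_le (digit_approx_nd x) (digit_approx_cvg x) L. Qed.

Lemma cantor_map_le L x : cantor_map x <= digit_approx L x + (2 ^+ L)^-1.
Proof.
apply: limr_le; first exact: digit_approx_cvg.
by apply: nearW => M; exact: digit_approx_le.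
Qed.

Lemma cantor_map_homo : {homo cantor_map : x y / x <= y}.
Proof.
move=> x y xy; apply: ler_lim; [exact: digit_approx_cvg..|].
by apply: nearW => L; exact: digit_approx_homo.
Qed.

Lemma cantor_map_itv x : T 0%N = 0%N -> 0 <= cantor_map x <= 1 / 2.
Proof.
move=> T0; have := cantor_map_ge 1 x; have := cantor_map_le 1 x.
rewrite /digit_approx /= /forced /= T0 leqnn /= muln0 mul0r add0r expr1 div1r.
by move=> -> ->.
Qed.
End forced_digits.

(** * The Cantor measure *)

Section uniform_law.
Variable R : realType.

Definition uniform01 : set (measurableTypeR R) -> \bar R :=
  mrestr lebesgue_measure (measurable_itv `[0 : R, 1[).

HB.instance Definition _ := Measure.on uniform01.

Lemma uniform01_setT : uniform01 setT = 1%E.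
Proof.
by rewrite /uniform01 /mrestr setTI lebesgue_measure_itv/= lte01 oppr0 adde0.
Qed.

HB.instance Definition _ :=
  Measure_isProbability.Build _ _ _ uniform01 uniform01_setT.
End uniform_law.

Section cantor_measure.
Variables (R : realType) (T : nat -> nat).
Hypothesis T0 : T 0%N = 0%N.

Definition cantor_angle (x : R) : R := 2 * pi * cantor_map T R x.

Lemma measurable_cantor_angle :
  measurable_fun setT (cantor_angle : measurableTypeR R -> measurableTypeR R).
Proof.
apply: nondecreasing_measurable => // x y xy.
by rewrite ler_pM2l ?cantor_map_homo// mulr_gt0// pi_gt0.
Qed.

HB.instance Definition _ := isMeasurableFun.Build _ _ _ _
  (cantor_angle : measurableTypeR R -> measurableTypeR R) measurable_cantor_angle.

Definition cantor_measure (m : {nonneg R}) :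
    {finite_measure set (measurableTypeR R) -> \bar R} :=
  mscale m (distribution (uniform01 R)
    (cantor_angle : measurableTypeR R -> measurableTypeR R)).

Lemma cantor_measureE m A :
  cantor_measure m A = (m%:num%:E * uniform01 R (cantor_angle @^-1` A))%E.
Proof. by []. Qed.

(** T 0 = 0 forces the leading digit to be zero. *)
Lemma cantor_angle_itv x : 0 <= cantor_angle x <= pi.
Proof.
have /andP[g0 g1] := cantor_map_itv T R x T0.
by have := pi_gt0 R; rewrite /cantor_angle; nra.
Qed.

Lemma cantor_angle_circle : cantor_angle @^-1` (@circle_param R) = setT.
Proof.
apply/seteqP; split=> // x _; rewrite /circle_param /= in_itv/=.
by have := cantor_angle_itv x; have := pi_gt0 R; lra.
Qed.

Lemma measurable_free_index L i :
  measurable ([set x | free_index T R L x = i] : set (measurableTypeR R)).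
Proof.
have mf : measurable_fun setT (fun x : R => (free_index T R L x)%:R : R).
  apply: nondecreasing_measurable => // x y xy.
  by rewrite ler_nat free_index_homo.
have := mf measurableT [set i%:R] (measurable_set1 _); rewrite setTI.
congr (measurable _); apply/seteqP; split => x /=; last by move=> ->.
by move=> /eqP; rewrite eqr_nat => /eqP.
Qed.

Lemma uniform01_free_index L i :
  (uniform01 R [set x | free_index T R L x = i] <= (2 ^+ nfree T L)^-1%:E)%E.
Proof.
set n := nfree T L; have p0 : 0 < 2 ^+ n :> R by rewrite exprn_gt0.
pose J : set R := `[i%:R / 2 ^+ n, i.+1%:R / 2 ^+ n[%classic.
have -> : ((2 ^+ n)^-1%:E = lebesgue_measure J)%E.
  rewrite lebesgue_measure_itv/= lte_fin ltr_pM2r ?invr_gt0// ltr_nat ltnSn.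
  rewrite -EFinD; congr EFin; rewrite -[in RHS]natr1; field.
  by rewrite expf_neq0.
apply: le_measure; rewrite ?inE.
- by apply: measurableI => //; exact: measurable_free_index.
- exact: measurable_itv.
- move=> x [/= xi]; rewrite !in_itv/= => /andP[x0 x1].
  move: xi; rewrite /free_index -/n => xi.
  have /andP[h1 h2] := truncn_itv (mulr_ge0 (ltW p0) x0).
  have ti : Num.truncn (2 ^+ n * x) = i.
    rewrite -xi; apply/esym/minn_idPl; rewrite -ltnS prednK ?expn_gt0//.
    by rewrite -(ltr_nat R) (le_lt_trans h1)// natrX gtr_pMr.
  rewrite ti in h1 h2; rewrite /J /= in_itv/=.
  by rewrite ler_pdivrMr// ltr_pdivlMr// mulrC h1 h2.
Qed.

(** A function dominated by c on each cell of level L: the cells have mass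
    2^-nfree, and distinct cells pick distinct values of c. *)
Lemma uniform01_integral_le L (c : nat -> R) (h : R -> R) :
  (forall j, 0 <= c j) -> (forall x, 0 <= h x) ->
  measurable_fun setT (h : measurableTypeR R -> R) ->
  (forall x, h x <= c (insert0 T L (free_index T R L x))) ->
  (\int[uniform01 R]_x (h x)%:E <= ((\sum_(j < 2 ^ L) c j) / 2 ^+ nfree T L)%:E)%E.
Proof.
move=> c0 h0 mh hc; set n := nfree T L.
pose A i : set (measurableTypeR R) := [set x | free_index T R L x = i].
have mA i : measurable (A i) by exact: measurable_free_index.
pose C i := c (insert0 T L i).
apply: (@le_trans _ _ (\int[uniform01 R]_x (\sum_(i < 2 ^ n) (C i)%:E * (\1_(A i) x)%:E))%E).
  apply: ge0_le_integral => //.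
  - by move=> x _; rewrite lee_fin.
  - exact/measurable_EFinP.
  - apply: emeasurable_sum => i; apply: measurable_funeM.
    by apply/measurable_EFinP; exact: measurable_indic.
  - move=> x _; rewrite (bigD1 (Ordinal (free_index_lt T R L x)))//=.
    rewrite indicE mem_set// mule1; apply: (@le_trans _ _ (C (free_index T R L x))%:E).
      by rewrite lee_fin hc.
    by rewrite leeDl// sume_ge0// => i _; rewrite mule_ge0// lee_fin// /C.
rewrite ge0_integral_sum//; last 2 first.
- move=> i; apply: measurable_funeM.
  by apply/measurable_EFinP; exact: measurable_indic.
- by move=> i x _; rewrite mule_ge0// lee_fin// /C.
apply: (@le_trans _ _ (\sum_(i < 2 ^ n) (C i / 2 ^+ n)%:E)%E).
  apply: lee_sum => i _; rewrite ge0_integralZl ?lee_fin /C//; first last.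
    by apply/measurable_EFinP; exact: measurable_indic.
  rewrite integral_indic// setIT EFinM lee_wpmul2l ?lee_fin /C//.
  exact: uniform01_free_index.
rewrite sumEFin lee_fin -mulr_suml ler_wpM2r ?invr_ge0 ?exprn_ge0//.
exact: sum_insert0.
Qed.

Lemma cantor_measure_on_circle m : on_circle (cantor_measure m).
Proof.
have e : cantor_angle @^-1` (~` @circle_param R) = set0.
  by rewrite -preimage_setC cantor_angle_circle setCT.
apply: etrans (cantor_measureE m _) _.
by rewrite [X in uniform01 _ X]e measure0 mule0.
Qed.

Lemma cantor_measure_circle m :
  cantor_measure m (@circle_param R) = m%:num%:E.
Proof.
apply: etrans (cantor_measureE m _) _.
by rewrite [X in uniform01 _ X]cantor_angle_circle uniform01_setT mule1.
Qed.

(** For every L the support is covered by 2^nfree arcs of length 2 pi / 2^L,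
    of total length 2 pi / 2^nforced. *)
Lemma cantor_measure_singular m : lebesgue_singular (cantor_measure m).
Proof.
pose J L i : set R :=
  `[2 * pi * ((insert0 T L i)%:R / 2 ^+ L),
    2 * pi * ((insert0 T L i)%:R / 2 ^+ L + (2 ^+ L)^-1)]%classic.
pose N := \bigcap_L \big[setU/set0]_(i < 2 ^ nfree T L) J L i.
have JE L i : lebesgue_measure (J L i) = (2 * pi / 2 ^+ L)%:E.
  rewrite lebesgue_measure_itv/= lte_fin ltr_pM2l ?mulr_gt0 ?pi_gt0//.
  by rewrite ltrDl invr_gt0 exprn_gt0// -EFinD; congr EFin; ring.
have mJ L : measurable (\big[setU/set0]_(i < 2 ^ nfree T L) J L i).
  by apply: bigsetU_measurable => i _; exact: measurable_itv.
have mN : measurable N by exact: bigcap_measurable.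
exists N; split => //; last first.
  apply: etrans (cantor_measureE m _) _.
  rewrite (_ : _ @^-1` _ = set0) ?measure0 ?mule0// -preimage_setC -setCT.
  congr (~` _).
  apply/seteqP; split=> // x _ L _; rewrite -bigcup_mkord.
  exists (free_index T R L x); first exact: free_index_lt.
  rewrite /J /= in_itv/= !ler_pM2l ?mulr_gt0 ?pi_gt0//.
  by rewrite cantor_map_ge cantor_map_le.
have NL L : (lebesgue_measure N <= (2 * pi / 2 ^+ nforced T L)%:E)%E.
  apply: (@le_trans _ _ (lebesgue_measure (\big[setU/set0]_(i < 2 ^ nfree T L) J L i))).
    by apply: le_measure; [exact/mem_set|exact: (mem_set (mJ L))|move=> x; apply].
  apply: le_trans (Boole_inequality _ _) _; first by move=> i _; exact: measurable_itv.
  rewrite (eq_bigr (fun=> (2 * pi / 2 ^+ L)%:E)) => [|i _]; last exact: JE.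
  rewrite sumEFin lee_fin sumr_const card_ord -[X in X <= _]mulr_natr natrX.
  have -> : 2 ^+ L = 2 ^+ nforced T L * 2 ^+ nfree T L :> R.
    by rewrite -exprD nforced_nfree.
  by rewrite invfM mulrA mulfVK// expf_neq0.
apply/eqP; rewrite eq_le measure_ge0 andbT.
apply/lee_addgt0Pr => e e0; rewrite add0e.
have [j hj] : exists j, 2 * pi / 2 ^+ j <= e.
  exists (Num.truncn (2 * pi / e)).+1.
  rewrite ler_pdivrMr ?exprn_gt0// [e * _]mulrC -ler_pdivrMr//.
  apply: le_trans (ltW (truncnS_gt _)) _.
  set k := (Num.truncn _).+1; rewrite -(natrX _ 2 k) ler_nat.
  by rewrite ltnW// ltn_expl.
have [L hL] := nforced_unbounded T j.
apply: le_trans (NL L) _; rewrite lee_fin (le_trans _ hj)//.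
rewrite ler_pM2l ?mulr_gt0 ?pi_gt0// lef_pV2 ?posrE ?exprn_gt0//.
by rewrite ler_weXn2l// ler1n.
Qed.

(** * The Poisson integral of the Cantor measure *)

Lemma poisson_integralE m x y : x ^+ 2 + y ^+ 2 < 1 ->
  (\int[cantor_measure m]_(t in @circle_param R) (poisson R x y t)%:E =
   m%:num%:E * \int[uniform01 R]_s (poisson R x y (cantor_angle s))%:E)%E.
Proof.
move=> xy1; have mp := measurable_poisson R _ _ xy1.
have mc : measurable (@circle_param R : set (measurableTypeR R)).
  exact: measurable_itv.
have mpc := measurable_funTS mp : measurable_fun (@circle_param R) _.
rewrite ge0_integral_mscale//; last 2 first.
- exact/measurable_EFinP.
- by move=> t _; rewrite lee_fin poisson_ge0.
congr (_ * _)%E.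
rewrite ge0_integral_pushforward//; last 2 first.
- exact/measurable_EFinP.
- by move=> t _; rewrite lee_fin poisson_ge0.
by rewrite [X in integral _ X]cantor_angle_circle.
Qed.

Definition potential m x y : R :=
  Rintegral (cantor_measure m) (@circle_param R) (poisson R x y).

Lemma potential_le_fin m x y B : x ^+ 2 + y ^+ 2 < 1 ->
  (\int[uniform01 R]_s (poisson R x y (cantor_angle s))%:E <= B%:E)%E ->
  potential m x y <= m%:num * B.
Proof.
move=> xy1 hB; rewrite /potential /Rintegral poisson_integralE//.
have : (0 <= \int[uniform01 R]_s (poisson R x y (cantor_angle s))%:E)%E.
  by apply: integral_ge0 => s _; rewrite lee_fin poisson_ge0.
by case: integral hB => [a| |]//; rewrite -EFinM/= !lee_fin => aB _; rewrite ler_wpM2l.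
Qed.

Lemma measurable_poisson_angle x y : x ^+ 2 + y ^+ 2 < 1 ->
  measurable_fun setT (poisson R x y \o cantor_angle : measurableTypeR R -> R).
Proof.
move=> xy1; apply: (measurableT_comp (measurable_poisson R _ _ xy1)).
exact: measurable_cantor_angle.
Qed.

(** On the cell of level L of s, the angle is within 2 pi / 2^L of the 2^L-th root
    of unity with index insert0; Harnack replaces the kernel by twice its value
    there, and the sum over all roots of unity is at most 2 2^L. *)
Lemma potential_le m r x y L : 0 <= r < 1 -> x ^+ 2 + y ^+ 2 <= r ^+ 2 ->
  8 * pi <= 2 ^+ L * (1 - r) ^+ 2 ->
  potential m x y <= m%:num * (4 * 2 ^+ nforced T L).
Proof.
move=> r01 xyr hL; have [r0 r1] := andP r01.
have xy1 : x ^+ 2 + y ^+ 2 < 1 by apply: le_lt_trans xyr _; rewrite expr_lt1.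
have pL : 0 < 2 ^+ L :> R by rewrite exprn_gt0.
have xy0 : 0 <= x ^+ 2 + y ^+ 2 by rewrite addr_ge0// sqr_ge0.
have rL : r ^+ (2 ^ L) <= 4^-1.
  have := bernoulli_decay R r (2 ^ L); rewrite r0 (ltW r1) natrX => /(_ isT).
  have : 0 <= r ^+ (2 ^ L) by rewrite exprn_ge0.
  move: hL; have := pi_ge2 R; move: (r ^+ (2 ^ L)) (2 ^+ L) pL => a K K0 pi2 hK a0 h.
  have : 16 <= K * (1 - r) by nra.
  nra.
have NL : (x ^+ 2 + y ^+ 2) ^+ (2 ^ L) <= (4^-1) ^+ 2.
  apply: le_trans (_ : (r ^+ 2) ^+ (2 ^ L) <= _).
    by apply: lerXn2r => //; rewrite nnegrE// sqr_ge0.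
  by rewrite exprAC; apply: lerXn2r => //; rewrite nnegrE ?exprn_ge0.
pose c j := 2 * poisson R x y (0 + 2 * pi * (j%:R / 2 ^+ L)).
apply: potential_le_fin => //.
apply: le_trans (uniform01_integral_le L c _ _ _ (measurable_poisson_angle _ _ xy1) _) _.
- by move=> j; rewrite mulr_ge0// poisson_ge0.
- by move=> s; exact: poisson_ge0.
- move=> s /=; apply: (poisson_harnack _ _ _ r01 xyr); rewrite add0r.
  rewrite /cantor_angle -mulrBr normrM ger0_norm ?mulr_ge0 ?pi_ge0//.
  have g1 := cantor_map_ge T R L s; have g2 := cantor_map_le T R L s.
  rewrite ger0_norm ?subr_ge0//.
  apply: (@le_trans _ _ (8 * pi / 2 ^+ L)).
    rewrite [leLHS]mulrA [4 * _]mulrA -natrM ler_pM2l ?mulr_gt0 ?pi_gt0//.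
    by rewrite lerBlDl.
  by rewrite ler_pdivrMr// [leRHS]mulrC.
rewrite lee_fin -mulr_sumr.
apply: (@le_trans _ _ (2 * (2 * 2 ^+ L) / 2 ^+ nfree T L)).
  rewrite ler_pM2r ?invr_gt0 ?exprn_gt0// ler_pM2l//.
  exact: poisson_roots_sum.
have -> : 2 ^+ L = 2 ^+ nforced T L * 2 ^+ nfree T L :> R.
  by rewrite -exprD nforced_nfree.
by rewrite !mulrA mulfK ?expf_neq0// -natrM.
Qed.

Lemma potential0 m : potential m 0 0 = m%:num.
Proof.
rewrite /potential (@eq_Rintegral _ _ _ _ _ (cst 1)); last first.
  move=> t _; rewrite /poisson /poisson_denom /= !mul0r expr0n/=.
  by rewrite !addr0 mulr0 subr0 divr1.
rewrite Rintegral_cst ?mul1r; last exact: measurable_itv.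
exact: (congr1 fine (cantor_measure_circle m)).
Qed.

(** At z = -i/2 the denominator is 5/4 + sin t, and sin t >= 0 on the support. *)
Lemma potential_gap m : potential m 0 (- 2^-1) <= m%:num * (3 / 5).
Proof.
have xy1 : (0 : R) ^+ 2 + (- 2^-1) ^+ 2 < 1 by lra.
apply: potential_le_fin => //.
apply: le_trans (uniform01_integral_le 0 (fun=> 3 / 5) _ _ _ (measurable_poisson_angle _ _ xy1) _) _.
- by move=> _; lra.
- by move=> s; exact: poisson_ge0.
- move=> s /=; rewrite /poisson ler_pdivrMr ?poisson_denom_gt0//.
  have := sin_ge0_pi (cantor_angle_itv s); rewrite /poisson_denom; lra.
by rewrite big_ord1 divr1.
Qed.

Lemma poisson_integrable m x y : x ^+ 2 + y ^+ 2 < 1 ->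
  (cantor_measure m).-integrable (@circle_param R) (EFin \o poisson R x y).
Proof.
move=> xy1; have [r r01 xyr] := disk_radius R xy1.
apply: measurable_bounded_integrable.
- exact: measurable_itv.
- exact: (eq_ind_r (fun z => (z < +oo)%E) (ltry _) (cantor_measure_circle m)).
- exact: (measurable_funTS (measurable_poisson R _ _ xy1)).
exists ((1 - r) ^- 2); split; first exact: num_real.
move=> M hM t _ /=; apply: le_trans (ltW hM).
rewrite ger0_norm ?poisson_ge0// /poisson ler_pdivrMr ?poisson_denom_gt0//.
have r1 : 0 < (1 - r) ^+ 2 by rewrite exprn_gt0// subr_gt0; case/andP: r01.
rewrite mulrC ler_pdivlMr//.
apply: le_trans (poisson_denom_ge R t r01 xyr).
by rewrite ler_piMl ?(ltW r1)// gerBl addr_ge0 ?sqr_ge0.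
Qed.

(** Continuity in z: it makes the minima of |S| on closed disks attained. *)
Lemma potential_lip m r x y x' y' : 0 <= r < 1 ->
  x ^+ 2 + y ^+ 2 <= r ^+ 2 -> x' ^+ 2 + y' ^+ 2 <= r ^+ 2 ->
  `|potential m x y - potential m x' y'| <=
  m%:num * (12 / (1 - r) ^+ 4) * (`|x - x'| + `|y - y'|).
Proof.
move=> r01 hz hw; have [r0 r1] := andP r01.
have rr1 : r ^+ 2 < 1 by rewrite expr_lt1.
have iz := poisson_integrable m _ _ (le_lt_trans hz rr1).
have iw := poisson_integrable m _ _ (le_lt_trans hw rr1).
have mc : measurable (@circle_param R : set (measurableTypeR R)).
  exact: measurable_itv.
rewrite /potential -RintegralB//.
have izw : (cantor_measure m).-integrable (@circle_param R)
    (EFin \o (fun t => poisson R x y t - poisson R x' y' t)).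
  by have := integrableB mc iz iw.
apply: le_trans (le_normr_Rintegral mc izw) _.
pose K := 12 / (1 - r) ^+ 4 * (`|x - x'| + `|y - y'|).
apply: (@le_trans _ _ (Rintegral (cantor_measure m) (@circle_param R) (cst K))).
  apply: le_Rintegral => //.
  - exact: integrable_norm.
  - exact: finite_measure_integrable_cst.
  - by move=> t _; exact: poisson_lip.
rewrite Rintegral_cst// (_ : fine _ = m%:num).
  by rewrite mulrC mulrA.
exact: (congr1 fine (cantor_measure_circle m)).
Qed.

End cantor_measure.

(** * Thresholds adapted to the growth of the rate *)

Section rate.
Variable R : realType.

(** Lam may oscillate: the lower bounds lam 2^j hold on [rad j, 1), and j is the
    least index with r < rad (j+1), so that r >= rad j when j > 0.  Having
    rad j >= 1 - 1/(j+1) makes such a j exist. *)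
Lemma rate_thresholds (Lam : R -> R) (lam : R) :
  (forall r, 0 <= r < 1 -> lam <= Lam r) ->
  (forall M, exists2 rho, rho < 1 & forall r, rho <= r < 1 -> M <= Lam r) ->
  exists T : nat -> nat, T 0%N = 0%N /\ forall r, 0 <= r < 1 ->
    exists j, 8 * pi <= 2 ^+ T j.+1 * (1 - r) ^+ 2 /\ lam * 2 ^+ j <= Lam r.
Proof.
move=> hlam hinf.
have /choice[rad hrad] : forall j : nat, exists rad : R, [/\ rad < 1,
    1 - j.+1%:R^-1 <= rad & forall r, rad <= r < 1 -> lam * 2 ^+ j <= Lam r].
  move=> j; have [rho rho1 hrho] := hinf (lam * 2 ^+ j).
  exists (Num.max rho (1 - j.+1%:R^-1)); split.
  - by rewrite gt_max rho1 gtrBl invr_gt0 ltr0n.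
  - by rewrite le_max lexx orbT.
  - by move=> r /andP[]; rewrite ge_max => /andP[h _] r1; rewrite hrho ?h.
have /choice[L hL] : forall j, exists L, 8 * pi <= 2 ^+ L * (1 - rad j) ^+ 2.
  move=> j; have [rad1 _ _] := hrad j.
  (* 2^k > k, so any k above 8 pi / (1 - rad j)^2 works. *)
  have d0 : 0 < (1 - rad j) ^+ 2 by rewrite exprn_gt0// subr_gt0.
  pose k := (Num.truncn (8 * pi / (1 - rad j) ^+ 2)).+1.
  exists k; rewrite -ler_pdivrMr//; apply: le_trans (ltW (truncnS_gt _)) _.
  by rewrite -(natrX _ 2 k) ler_nat ltnW// ltn_expl.
exists (fun j => if j is j'.+1 then L j else 0%N); split => // r /andP[r0 r1].
have exn : exists n, r < rad n.+1.
  pose n := Num.truncn (1 - r)^-1; exists n; have [_ + _] := hrad n.+1.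
  apply: lt_le_trans; rewrite ltrBrDl -ltrBrDr.
  rewrite -[ltRHS]invrK ltf_pV2 ?posrE ?invr_gt0 ?subr_gt0// ?ltr0n//.
  by apply: lt_trans (truncnS_gt _) _; rewrite ltr_nat.
case: (ex_minnP exn) => n rn nmin; exists n; split.
  apply: le_trans (hL n.+1) _; rewrite ler_pM2l ?exprn_gt0//.
  have [rad1 _ _] := hrad n.+1.
  by apply: lerXn2r; rewrite ?nnegrE ?subr_ge0 ?lerB// ltW.
case: n rn nmin => [|n] rn nmin; first by rewrite mulr1 hlam ?r0.
have [_ _] := hrad n.+1; apply; rewrite r1 andbT leNgt.
by apply/negP => /nmin; rewrite ltnn.
Qed.

Lemma lnN_unbounded (omega : R -> R) :
  (forall r, 0 <= r < 1 -> 0 < omega r < 1) ->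
  omega r @[r --> (1 : R)^'-] --> (0 : R) ->
  forall M, exists2 rho, rho < 1 & forall r, rho <= r < 1 -> M <= - ln (omega r).
Proof.
move=> range lim M.
have : \forall r \near (1 : R)^'-, omega r < expR (- M).
  by apply: (cvgr_lt _ lim); exact: expR_gt0.
rewrite near_withinE => /nbhs_ballP[e /= e0 he].
exists (Num.max 0 (1 - e / 2)).
  by rewrite gt_max ltr01 gtrBl divr_gt0.
move=> r /andP[]; rewrite ge_max => /andP[r0 re] r1.
have /andP[w0 w1] : 0 < omega r < 1 by apply: range; rewrite r0.
rewrite lerNr -(expRK (- M)) ler_ln ?posrE ?expR_gt0//.
apply/ltW/he => //=; rewrite /ball/= gtr0_norm ?subr_gt0//; lra.
Qed.

End rate.

(** * Singular inner functions in real coordinates *)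

Section complex_disk.
Variable R : realType.

Lemma cmod_cexp (w : R[i]) : cmod (cexp w) = expR (complex.Re w).
Proof.
case: w => a b; rewrite /cmod /cexp /= !mul0r subr0 addr0 !exprMn -mulrDr.
by rewrite cos2Dsin2 mulr1 sqrtr_sqr gtr0_norm// expR_gt0.
Qed.

Lemma cmod_le (x y r : R) : 0 <= r ->
  (cmod (x +i* y) <= r) = (x ^+ 2 + y ^+ 2 <= r ^+ 2).
Proof.
move=> r0; rewrite /cmod /= -{1}(ger0_norm r0) -sqrtr_sqr ler_sqrt//.
exact: sqr_ge0.
Qed.

Lemma unit_diskE (x y : R) : unit_disk (x +i* y) = (x ^+ 2 + y ^+ 2 < 1) :> Prop.
Proof. by rewrite /unit_disk /cmod /= -{1}sqrtr1 ltr_sqrt. Qed.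

(** The real part of (w + z) / (w - z) is (|w|^2 - |z|^2) / |w - z|^2. *)
Lemma Re_herglotz (x y t : R) : x ^+ 2 + y ^+ 2 < 1 ->
  complex.Re ((circle_pt t + (x +i* y)) / (circle_pt t - (x +i* y))) =
  poisson R x y t.
Proof.
move=> xy1; have := poisson_denom_gt0 R t xy1.
rewrite /circle_pt /cexp /= expR0 !mul1r !mul0r subr0 addr0.
rewrite /poisson /poisson_denom; have := cos2Dsin2 t.
set c := cos t; set s := sin t => cs d0.
have s2 : s ^+ 2 = 1 - c ^+ 2 by rewrite -cs; ring.
have -> : (c - x) ^+ 2 + (s - y) ^+ 2 =
    1 + (x ^+ 2 + y ^+ 2) - 2 * (x * c + y * s) by ring: s2.
rewrite mulrN opprK !mulrA -mulrDl; congr (_ / _).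
by ring: s2.
Qed.

Lemma disk_compact (r : R) : 0 <= r <= 1 ->
  compact [set p : R * R | p.1 ^+ 2 + p.2 ^+ 2 <= r ^+ 2].
Proof.
move=> /andP[r0 r1].
have cX := compact_setX (@segment_compact R (-1) 1) (@segment_compact R (-1) 1).
apply: subclosed_compact cX _.
  rewrite (_ : [set p | _] = (fun p : R * R => p.1 ^+ 2 + p.2 ^+ 2) @^-1`
    [set u | u <= r ^+ 2])//.
  apply: closed_comp; last exact: closed_le.
  move=> p _; apply: cvgD; apply: (@cvgM R _ _ _ (fun q => _) (fun q => _)).
  - exact: cvg_fst. - exact: cvg_fst. - exact: cvg_snd. - exact: cvg_snd.
move=> [x y] /= h; rewrite !in_itv/=.
have x0 := sqr_ge0 x; have y0 := sqr_ge0 y.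
have r21 : r ^+ 2 <= 1 by rewrite expr_le1.
by split; rewrite -ler_norml -[_ <= 1](@ler_pXn2r _ 2)// ?nnegrE// expr1n
  real_normK ?num_real//; lra.
Qed.

Lemma lip_within_continuous (f : R * R -> R) (K : set (R * R)) (C : R) :
  (forall p q, K p -> K q -> `|f p - f q| <= C * (`|p.1 - q.1| + `|p.2 - q.2|)) ->
  {within K, continuous f}.
Proof.
move=> hC; apply/subspace_continuousP => p Kp.
apply/cvgrPdist_lt => e e0; rewrite near_withinE.
pose d := e / (2 * `|C| + 1); have d0 : 0 < d by rewrite divr_gt0// ltr_wpDl.
apply/nbhs_ballP; exists d => // q [/= q1 q2] Kq.
apply: le_lt_trans (hC _ _ Kp Kq) _; rewrite /ball/= in q1 q2.
have h : C * (`|p.1 - q.1| + `|p.2 - q.2|) <= `|C| * (d + d).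
  apply: le_trans (ler_norm _) _; rewrite normrM ler_wpM2l//.
  by rewrite ger0_norm ?addr_ge0// lerD// ltW.
apply: le_lt_trans h _.
have -> : e = (2 * `|C| + 1) * d by rewrite /d mulrC divfK// gt_eqF// ltr_wpDl.
by move: (normr_ge0 C); set c := `|C| => c0; nra.
Qed.

End complex_disk.

(** * Singular inner functions decaying slower than a given rate *)

Theorem mainTheorem1 (R : realType) (omega : R -> R)
  (omega_range : forall r : R, 0 <= r < 1 -> 0 < omega r < 1)
  (omega_sup : sup [set omega r | r in [set r : R | 0 <= r < 1]] < 1)
  (omega_lim : omega r @[r --> (1 : R)^'-] --> (0 : R)) :
  exists S : R[i] -> R[i],
    [/\ singular_inner S,
        nonconstant_on_disk S &
        forall r : R, 0 <= r < 1 ->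
          exists2 m : R,
            is_min [set cmod (S z) | z in [set z : R[i] | cmod z <= r]] m &
            omega r <= m].
Proof.
set s := sup _ in omega_sup.
have omega_le r : 0 <= r < 1 -> omega r <= s.
  move=> r01; apply: ub_le_sup; last by exists r.
  by exists 1 => _ [q q01 <-]; apply/ltW; case/andP: (omega_range q q01).
have s0 : 0 < s.
  have h0 : 0 <= (0 : R) < 1 by rewrite lexx ltr01.
  by apply: lt_le_trans (omega_le _ h0); case/andP: (omega_range _ h0).
pose lam := - ln s; have lam0 : 0 < lam by rewrite oppr_gt0 ln_lt0// s0.
have Lam_ge r : 0 <= r < 1 -> lam <= - ln (omega r).
  move=> r01; have /andP[w0 _] := omega_range r r01.
  by rewrite lerN2 ler_ln ?posrE// omega_le.
have [T [T0 hT]] := rate_thresholds _ _ _ Lam_ge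
  (lnN_unbounded _ _ omega_range omega_lim).
have m0 : 0 <= lam / 8 by rewrite divr_ge0// ltW.
(* 8 = 4 * 2: the 4 of potential_le, and one forced digit more than the index
   j given by rate_thresholds. *)
pose m := NngNum m0.
pose mu := cantor_measure R T m.
pose S (z : R[i]) := cexp (- cintegral mu (@circle_param R)
   (fun t => (circle_pt t + z) / (circle_pt t - z))).
have cmodS x y : x ^+ 2 + y ^+ 2 < 1 ->
    cmod (S (x +i* y)) = expR (- potential R T m x y).
  move=> xy1; rewrite cmod_cexp /=; congr (expR (- _)).
  by apply: eq_Rintegral => t _; exact: Re_herglotz.
exists S; split.
- exists mu; split => //.
  + exact: cantor_measure_on_circle.
  + exact: cantor_measure_singular.
- move=> [c hc].
  have h0 : (0 : R) ^+ 2 + 0 ^+ 2 < 1 by rewrite expr0n/= addr0.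
  have h1 : (0 : R) ^+ 2 + (- 2^-1) ^+ 2 < 1 by lra.
  have S0 : S (0 +i* 0) = c by apply: hc; rewrite unit_diskE.
  have S1 : S (0 +i* (- 2^-1)) = c by apply: hc; rewrite unit_diskE.
  have := cmodS _ _ h0; rewrite S0 -S1 cmodS// => /expR_inj/oppr_inj.
  rewrite potential0// => e; have := potential_gap R T T0 m.
  by rewrite e /=; lra.
- move=> r r01; have [r0 r1] := andP r01.
  have rr1 : r ^+ 2 < 1 by rewrite expr_lt1.
  pose K := [set p : R * R | p.1 ^+ 2 + p.2 ^+ 2 <= r ^+ 2].
  pose f (p : R * R) := potential R T m p.1 p.2.
  have cf : {within K, continuous f}.
    apply: (lip_within_continuous _ _ _ (m%:num * (12 / (1 - r) ^+ 4))).
    by move=> p q Kp Kq; exact: potential_lip.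
  have K0 : K !=set0 by exists (0, 0); rewrite /K /= expr0n/= addr0 sqr_ge0.
  have cK : compact K by apply: disk_compact; rewrite r0 ltW.
  have [p /set_mem Kp pmax] := compact_EVT_max K0 cK cf.
  have Kdisk x y : x ^+ 2 + y ^+ 2 <= r ^+ 2 -> x ^+ 2 + y ^+ 2 < 1.
    by move=> h; exact: le_lt_trans rr1.
  exists (expR (- f p)).
    split.
      exists (p.1 +i* p.2); first by rewrite /= cmod_le.
      by rewrite cmodS ?Kdisk.
    move=> _ [[x y] zr <-]; have Kxy : x ^+ 2 + y ^+ 2 <= r ^+ 2.
      by rewrite -cmod_le.
    rewrite cmodS ?Kdisk// ler_expR lerN2.
    by apply: (pmax (x, y)); exact/mem_set.
  have [j [hj hlam]] := hT r r01.
  have /andP[w0 _] := omega_range r r01.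
  rewrite -(@lnK R (omega r)) ?posrE// ler_expR lerNr.
  apply: le_trans hlam.
  apply: le_trans (potential_le R T T0 m r _ _ _ r01 Kp hj) _.
  have := nforced_threshold T j.+1; set k := nforced _ _ => kj.
  have : 2 ^+ k <= 2 ^+ j.+1 :> R by rewrite ler_weXn2l// ler1n.
  by rewrite /= exprS; set a := 2 ^+ k; set b := 2 ^+ j => ab; nra.
Qed.
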